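(* Let $d\in\{4,5,6\}$ and let $m>d$ be an integer. Then \[ f_{\triangle}(d,m)=\begin{cases}1+dm+\lfloor d/2\rfloor\lfloor m/(d+1)\rfloor & \text{if } d+1 \text{ divides } m+1,\\ dm+\lfloor d/2\rfloor\lfloor m/(d+1)\rfloor & \text{otherwise.}\end{cases} \]
   Context: All graphs are finite, simple and undirected. A graph is triangle-free if it has no three pairwise adjacent vertices. $\Delta(G)$ is the maximum degree and $\nu(G)$ the matching number of $G$. For positive integers $d,m$, $f_{\triangle}(d,m)$ is the maximum number of edges of a triangle-free graph $G$ with $\Delta(G)\le d$ and $\nu(G)\le m$. *)

(* Defs.v *)
From mathcomp Require Import all_boot.

Set Implicit Arguments.
Unset Strict Implicit.
Unset Printing Implicit Defensive.

Record sgraph : Type := SGraph {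
  vertex :> finType;
  adj : rel vertex;
  adj_sym : symmetric adj;
  adj_irrefl : irreflexive adj
}.

Section GraphParameters.
Variable G : sgraph.

Definition edges : {set {set G}} :=
  [set [set x; y] | x in G, y in G & adj x y].

Definition degree (x : G) : nat := #|[set y : G | adj x y]|.

Definition max_degree : nat := \max_(x : G) degree x.

Definition triangle_free : Prop :=
  forall x y z : G, ~ [/\ adj x y, adj y z & adj x z].

Definition matching (M : {set {set G}}) : bool :=
  (M \subset edges) && trivIset M.

Definition matching_number : nat := \max_(M : {set {set G}} | matching M) #|M|.

End GraphParameters.

Definition admissible (d m : nat) (G : sgraph) : Prop :=
  [/\ triangle_free G, max_degree G <= d & matching_number G <= m].

(* f_triangle d m k says that the maximum f_triangle(d,m) is k: a maximum over
   the proper class of all finite graphs is stated as an attained upper bound. *)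
Definition f_triangle (d m k : nat) : Prop :=
  (exists2 G : sgraph, admissible d m G & #|edges G| = k) /\
  (forall G : sgraph, admissible d m G -> #|edges G| <= k).

(* Main.v *)
Require Import Defs.
From mathcomp Require Import all_boot zify.

(* Upper bound.  By induction on a vertex set A, the number e(A) of edges inside
   A is at most d k + floor(d/2) a + b for some matching of size k inside A and
   some a, b with a (d+1) + b d <= k.  A vertex covered by every maximum
   matching of A can be deleted, at a cost of d edges and one matching edge.
   Otherwise, by Gallai's lemma, the relation "no maximum matching of A misses
   both x and y" is an equivalence whose classes C are unions of components with at most
   2k+1 vertices, where k is the matching number of C.  Then e(C) is bounded by
   Mantel's theorem if k < d, by d^2 + 1 if k = d, and by half the degree sum if
   k > d.

   Lower bound.  Disjoint unions of almost d-regular triangle-free graphs on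
   2d+3 vertices, of stars K_{1,d}, and of at most one K_{d,d} with a subdivided
   edge. *)

Set Implicit Arguments.
Unset Strict Implicit.
Unset Printing Implicit Defensive.

(** * Degree sums inside a vertex set; edge bounds for triangle-free graphs *)

Section DegreeSums.
Variable G : sgraph.
Implicit Types (x y v w : G) (A B C W S : {set G}).

Lemma adj_neq x y : adj x y -> x != y.
Proof. by apply: contraTneq => ->; rewrite adj_irrefl. Qed.

Definition degree_in A x : nat := \sum_(y in A) adj x y.

(** Twice the number of edges inside [A]; keeping it doubled avoids halving. *)
Definition degree_sum A : nat := \sum_(x in A) degree_in A x.

Lemma degree_inT x : degree_in setT x = degree x.
Proof.
rewrite /degree_in /degree -sum1_card [RHS]big_mkcond [LHS]big_mkcond /=.
by apply: eq_bigr => y _; rewrite inE in_setT; case: (adj x y).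
Qed.

Lemma degree_in_card A x : degree_in A x = #|[set y in A | adj x y]|.
Proof.
rewrite /degree_in -sum1_card [RHS]big_mkcond [LHS]big_mkcond /=.
by apply: eq_bigr => y _; rewrite inE; case: (y \in A); case: (adj x y).
Qed.

Lemma degree_inID A B x :
  degree_in A x = degree_in (A :&: B) x + degree_in (A :\: B) x.
Proof. exact: big_setID. Qed.

Lemma degree_inS A B x : A \subset B -> degree_in A x <= degree_in B x.
Proof. by move=> sAB; rewrite (degree_inID B A) (setIidPr sAB) leq_addr. Qed.

Lemma degree_inD1 A v x :
  v \in A -> degree_in A x = adj x v + degree_in (A :\ v) x.
Proof. by move=> vA; rewrite /degree_in (big_setD1 v). Qed.

Lemma degree_in_le A x : degree_in A x <= max_degree G.
Proof.
apply: leq_trans (degree_inS x (subsetT A)) _; rewrite degree_inT.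
exact: (@leq_bigmax G (@degree G)).
Qed.

Lemma sum_degree_inC A B :
  \sum_(x in A) degree_in B x = \sum_(x in B) degree_in A x.
Proof.
rewrite /degree_in exchange_big /=; apply: eq_bigr => x _.
by apply: eq_bigr => y _; rewrite adj_sym.
Qed.

Lemma degree_sum_split A B :
  degree_sum A = degree_sum (A :&: B) + degree_sum (A :\: B)
                 + (\sum_(x in A :&: B) degree_in (A :\: B) x).*2.
Proof.
rewrite /degree_sum (big_setID B) /=.
under eq_bigr => x _ do rewrite (degree_inID A B).
under [X in _ + X]eq_bigr => x _ do rewrite (degree_inID A B).
rewrite !big_split /= (sum_degree_inC (A :\: B)); lia.
Qed.

Lemma degree_sumD1 A v :
  v \in A -> degree_sum A = degree_sum (A :\ v) + (degree_in A v).*2.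
Proof.
move=> vA; rewrite (degree_sum_split A [set v]).
have -> : A :&: [set v] = [set v].
  by apply/setIidPr; rewrite sub1set.
rewrite big_set1 (degree_inD1 v vA) /degree_sum big_set1 /degree_in big_set1.
by rewrite adj_irrefl.
Qed.

(** Deleting a vertex removes an even amount. This parity is what rounds [d / 2] down in the bound
    for large components. *)
Lemma degree_sum_even A : ~~ odd (degree_sum A).
Proof.
have [n] := ubnP #|A|; elim: n A => // n IHn A cA.
have [->|[v vA]] := set_0Vmem A; first by rewrite /degree_sum big_set0.
rewrite (degree_sumD1 vA) oddD odd_double addbF; apply: IHn.
by move: cA; rewrite (cardsD1 v) vA.
Qed.

Lemma degree_sum_le A : degree_sum A <= #|A| * max_degree G.
Proof.
by rewrite -sum_nat_const; apply: leq_sum => x _; apply: degree_in_le.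
Qed.

Lemma edgesP (E : {set G}) :
  reflect (exists x y, adj x y /\ E = [set x; y]) (E \in edges G).
Proof.
apply: (iffP imset2P) => [[x y _]|[x [y [xy ->]]]].
  by rewrite inE => /andP[_ xy] ->; exists x, y.
by exists x y => //; rewrite inE.
Qed.

Lemma handshake : degree_sum setT = (#|edges G|).*2.
Proof.
transitivity (\sum_(E in edges G) #|E|); last first.
  rewrite -muln2 -sum_nat_const; apply: eq_bigr => E /edgesP[x [y [xy ->]]].
  by rewrite cards2 adj_neq.
under [RHS]eq_bigr => E _ do rewrite -sum1_card big_mkcond /=.
rewrite exchange_big /= /degree_sum.
apply: eq_big => [x|x _]; first by rewrite in_setT.
rewrite degree_inT /degree -big_mkcondr sum1_card.
rewrite -(card_in_imset (f := fun y => [set x; y])) => [|y z].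
  apply: eq_card => E; apply/imsetP/andP => [[y]|[/edgesP[u [v [uv ->]]]]].
    rewrite inE => xy ->; rewrite !inE eqxx; split=> //.
    by apply/edgesP; exists x, y.
  rewrite !inE => /orP[]/eqP->; first by exists v; rewrite ?inE.
  by exists u; rewrite ?inE 1?adj_sym // setUC.
rewrite !inE => xy xz /setP/(_ y); rewrite !inE eqxx orbT eq_sym.
by rewrite (negPf (adj_neq xy)) /= => /esym/eqP.
Qed.

Hypothesis tfG : triangle_free G.

Lemma degree_in_edge A x y :
  adj x y -> degree_in A x + degree_in A y <= #|A|.
Proof.
move=> xy; rewrite /degree_in -big_split /= -sum1_card; apply: leq_sum => z _.
case xz: (adj x z); case yz: (adj y z) => //; by case: (tfG (And3 xy yz xz)).
Qed.

(** Without triangles the neighbourhood [B] is independent, so no edge lies inside it. *)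
Lemma neighbourhood_split A u :
  let B := [set y in A | adj u y] in
  degree_sum A
    = (\sum_(x in B) degree_in (A :\: B) x).*2 + degree_sum (A :\: B).
Proof.
move=> B; rewrite (degree_sum_split A B).
have -> : A :&: B = B by apply/setIidPr; rewrite /B setIdE subsetIl.
rewrite {1}/degree_sum big1 ?add0n 1?addnC // => x xB.
rewrite /degree_in big1 // => y yB; apply/eqP; rewrite eqb0; apply/negP => xy.
move: xB yB; rewrite !inE => /andP[_ ux] /andP[_ uy].
exact: (tfG (And3 ux xy uy)).
Qed.

Lemma max_degree_in A v : v \in A ->
  exists2 u, u \in A & forall x, x \in A -> degree_in A x <= degree_in A u.
Proof.
move=> vA; case: (@arg_maxnP _ v (mem A) (degree_in A)) => // u uA um.
by exists u.
Qed.

(** Let [B] be the neighbourhood of a vertex of maximum degree in [A]. Since [B] is independent,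
    every edge meets [A :\: B], so there are at most [#|B| * #|A :\: B|] edges, and AM-GM
    concludes. *)
Lemma mantel A : (degree_sum A).*2 <= #|A| ^ 2.
Proof.
have [->|[v vA]] := set_0Vmem A; first by rewrite /degree_sum big_set0.
have [u uA um] := max_degree_in vA.
have := neighbourhood_split A u; set B := [set y in A | adj u y] => /= eA.
have sBA : B \subset A by rewrite /B setIdE subsetIl.
have cB : #|B| = degree_in A u by rewrite degree_in_card.
have cA : #|A| = #|B| + #|A :\: B| by rewrite -(cardsID B A) (setIidPr sBA).
have : \sum_(x in A :\: B) degree_in A x <= #|A :\: B| * degree_in A u.
  by rewrite -sum_nat_const; apply: leq_sum => x /setDP[xA _]; apply: um.
under eq_bigr => x _ do rewrite (degree_inID A B) (setIidPr sBA).
rewrite big_split /= sum_degree_inC -/(degree_sum (A :\: B)) -cB.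
have := nat_AGM2 #|B| #|A :\: B|; rewrite -cA => /leqifP; move: eA.
case: eqP; lia.
Qed.

(* With B the neighbourhood of a vertex of degree d and W its complement, an edge
   xy inside W is compensated by deg_B x + deg_B y <= d; every further edge inside
   W costs one of the at most d^2 edges between B and W. *)
Lemma degree_sum_order_2d1 d A : max_degree G <= d -> #|A| = d.*2.+1 ->
  degree_sum A <= (d ^ 2).*2 + 2.
Proof.
move=> dG cA.
have [v vA] : exists v, v \in A.
  by apply/set0Pn; rewrite -card_gt0 cA.
have [u uA um] := max_degree_in vA.
have degA x B : degree_in B x <= d := leq_trans (degree_in_le B x) dG.
(* If no vertex has degree [d] in [A], the crude bound (2d+1)(d-1) is enough. *)
have [ltd|ged] := ltnP (degree_in A u) d.
  have : degree_sum A <= #|A| * d.-1.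
    rewrite -sum_nat_const; apply: leq_sum => x xA.
    by apply: leq_trans (um x xA) _; rewrite -ltnS prednK //; lia.
  rewrite cA; nia.
have := neighbourhood_split A u; set B := [set y in A | adj u y] => /= eA.
have sBA : B \subset A by rewrite /B setIdE subsetIl.
have cB : #|B| = d.
  by have := degA u A; rewrite /B -degree_in_card; lia.
set W := A :\: B in eA *.
have cW : #|W| = d.+1.
  by have := cardsID B A; rewrite (setIidPr sBA) cB cA -/W; lia.
have [x|W0] := pickP [pred x in W | degree_in W x != 0].
  move=> /andP[xW]; rewrite -lt0n => dx.
  have [y /setIdP[yW xy]] : exists y, y \in [set y in W | adj x y].
    by apply/set0Pn; rewrite -card_gt0 -degree_in_card.
  have yx : adj y x by rewrite adj_sym.
  have yWx : y \in W :\ x by rewrite in_setD1 adj_neq.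
  set R := W :\ x :\ y.
  have cR : #|R| = d.-1.
    by move: cW; rewrite (cardsD1 x) xW (cardsD1 y) yWx -/R; lia.
  have dW z : degree_in W z = adj z x + (adj z y + degree_in R z).
    by rewrite (degree_inD1 z xW) (degree_inD1 z yWx).
  have dR : \sum_(z in R) (degree_in B z + degree_in W z) <= d.-1 * d.
    rewrite -cR -sum_nat_const; apply: leq_sum => z _.
    by rewrite -[B](setIidPr sBA) -degree_inID.
  have eRW : degree_sum W <= 2 + (\sum_(z in R) degree_in W z).*2.
    rewrite /degree_sum (big_setD1 x) // (big_setD1 y) //= -/R.
    rewrite (dW x) (dW y) !adj_irrefl xy yx /=.
    have : degree_in R x + degree_in R y <= \sum_(z in R) degree_in W z.
      rewrite /degree_in -big_split /=; apply: leq_sum => z _.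
      by rewrite -/(degree_in W z) dW (adj_sym x) (adj_sym y); lia.
    lia.
  have eBW : \sum_(z in B) degree_in W z <= d + \sum_(z in R) degree_in B z.
    rewrite sum_degree_inC (big_setD1 x) // (big_setD1 y) //= -/R.
    by have := degree_in_edge B xy; rewrite cB; lia.
  by move: dR; rewrite big_split /=; nia.
have : degree_sum W = 0.
  by apply: big1 => x xW; have := W0 x; rewrite /= xW => /negbFE/eqP.
have : \sum_(x in B) degree_in W x <= #|B| * d.
  by rewrite -sum_nat_const; apply: leq_sum.
rewrite cB; nia.
Qed.

Lemma degree_sum_component d k C : max_degree G <= d -> #|C| <= k.*2.+1 ->
  exists a b, a * d.+1 + b * d <= k
    /\ degree_sum C <= (d * k + d %/ 2 * a + b).*2.
Proof.
move=> dG cC.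
have bC : degree_sum C <= #|C| * d.
  by apply: leq_trans (degree_sum_le C) _; rewrite leq_mul2l dG orbT.
case: (ltngtP k d) => [ltkd|ltdk|ekd].
(* Mantel leaves at most k(k+1) <= dk edges, so no surplus arises. *)
- exists 0, 0; split=> //; have := mantel C; nia.
(* The degree sum is even and at most 2dk + d, hence at most 2dk + 2 floor(d/2). *)
- exists 1, 0; split; first lia.
  have := degree_sum_even C; have : degree_sum C <= k.*2.+1 * d.
    by apply: leq_trans bC _; rewrite leq_mul2r cC orbT.
  nia.
subst k; exists 0, 1; split; first lia.
(* With at most 2d vertices, half the degree sum is at most d^2; only order 2d+1 can reach d^2 +
   1. *)
move: cC; rewrite leq_eqVlt => /orP[/eqP cC|]; last by nia.
have := degree_sum_order_2d1 dG cC; nia.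
Qed.

End DegreeSums.

(** * Matchings, alternating paths and Gallai's lemma *)

Section Matchings.
Variable G : sgraph.
Implicit Types (x y v w z : G) (A C S N : {set G}).

(* [matchable S]: some matching of G covers exactly the vertices of S. *)
Inductive matchable : {set G} -> Prop :=
| Matchable0 : matchable set0
| MatchableU x y S : adj x y -> x \notin S -> y \notin S -> matchable S ->
    matchable (x |: (y |: S)).

Lemma matchable_cover (M : {set {set G}}) : matching M -> matchable (cover M).
Proof.
have [n] := ubnP #|M|; elim: n M => // n IHn M cM /andP[sM tM].
have [->|[E EM]] := set_0Vmem M; first by rewrite /cover big_set0; constructor.
have /edgesP[x [y [xy eE]]] := subsetP sM E EM.
have -> : cover M = x |: (y |: cover (M :\ E)).
  by rewrite /cover (big_setD1 E) //= eE setUA.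
have disj z : z \in E -> z \notin cover (M :\ E).
  move=> zE; apply/bigcupP => -[F /setD1P[FE FM] zF].
  have /trivIsetP/(_ E F EM FM) := tM; rewrite eq_sym => /(_ FE).
  by move/disjoint_setI0/setP/(_ z); rewrite !inE zE zF.
constructor=> //; try by apply: disj; rewrite eE !inE eqxx ?orbT.
apply: IHn; first by move: cM; rewrite (cardsD1 E) EM.
rewrite /matching (subset_trans (subD1set M E)) //=.
exact: trivIsetS (subD1set M E) tM.
Qed.

Lemma card_cover_matching (M : {set {set G}}) :
  matching M -> #|cover M| = (#|M|).*2.
Proof.
move=> /andP[sM /eqP <-]; rewrite -muln2 -sum_nat_const.
apply: eq_bigr => E /(subsetP sM)/edgesP[x [y [xy ->]]].
by rewrite cards2 adj_neq.
Qed.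

(** Boolean form of [matchable], so that matchings of maximum size can be selected and quantified
    over by booleans. *)
Definition matchableb S : bool :=
  [exists M : {set {set G}}, matching M && (cover M == S)].

Lemma matchableP S : reflect (matchable S) (matchableb S).
Proof.
apply: (iffP existsP) => [[M /andP[mM /eqP <-]]|]; first exact: matchable_cover.
elim=> [|x y N xy xN yN _ [M /andP[/andP[sM tM] /eqP eM]]].
  exists set0; rewrite /matching sub0set /cover big_set0 eqxx andbT /=.
  by apply/trivIsetP => A B; rewrite inE.
exists ([set x; y] |: M); apply/andP; split; last first.
  rewrite /cover bigcup_setU big_set1 -/(cover M) eM.
  by rewrite setUA.
apply/andP; split.
  apply/subsetP => E /setU1P[->|/(subsetP sM)//].
  by apply/edgesP; exists x, y.
have disj E : E \in M -> [disjoint [set x; y] & E].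
  move=> EM; rewrite disjoint_subset; apply/subsetP => z zxy.
  rewrite !inE; apply/negP => zE.
  have : z \in N by rewrite -eM; apply/bigcupP; exists E.
  by move: zxy; rewrite !inE => /orP[]/eqP->; apply/negP.
apply/trivIsetP => E F /setU1P[->|EM] /setU1P[->|FM]; rewrite ?eqxx //.
- by move=> _; apply: disj.
- by move=> _; rewrite disjoint_sym; apply: disj.
by apply: (trivIsetP tM).
Qed.

Lemma matching_numberP m :
  reflect (forall S, matchable S -> #|S| <= m.*2) (matching_number G <= m).
Proof.
apply: (iffP (bigmax_leqP _ _ _)) => mG.
  move=> S /matchableP/existsP[M /andP[mM /eqP <-]].
  by rewrite card_cover_matching // leq_double mG.
move=> M mM; rewrite -leq_double -card_cover_matching //.
by apply: mG; apply: matchable_cover.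
Qed.

Lemma matchable_even S : matchable S -> ~~ odd #|S|.
Proof.
case/matchableP/existsP=> M /andP[mM /eqP <-].
by rewrite card_cover_matching // odd_double.
Qed.

Lemma card_matchableU x y S :
  adj x y -> x \notin S -> y \notin S -> #|x |: (y |: S)| = #|S|.+2.
Proof.
move=> xy xS yS; rewrite cardsU1 in_setU1 negb_or xS adj_neq //=.
by rewrite cardsU1 yS.
Qed.

(** Edges of a matching can be reordered, so the edge at any covered vertex may be taken as the last
    one added. *)
Lemma matchable_partner S v : matchable S -> v \in S ->
  exists w N, [/\ adj v w, v \notin N, w \notin N, matchable N
                & S = v |: (w |: N)].
Proof.
move=> mS; elim: mS v => [v|x y N xy xN yN mN IHN v]; first by rewrite inE.
case/setU1P=> [->|/setU1P[->|vN]].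
- by exists y, N.
- by exists x, N; split=> //; rewrite 1?adj_sym // setUCA.
have [w [N' [vw vN' wN' mN' eN]]] := IHN v vN.
move: (xN) (yN); rewrite eN !inE !negb_or.
case/and3P=> xv xw xN' /and3P[yv yw yN'].
exists w, (x |: (y |: N')); split=> //.
- by rewrite !inE !negb_or vN' (eq_sym v) xv (eq_sym v) yv.
- by rewrite !inE !negb_or wN' (eq_sym w) xw (eq_sym w) yw.
- by constructor.
apply/setP=> z; rewrite !inE.
by case: (z == x); case: (z == y); case: (z == v); case: (z == w).
Qed.

Lemma matchable_disjointU S N :
  matchable S -> matchable N -> [disjoint S & N] -> matchable (S :|: N).
Proof.
move=> mS mN; elim: mS => [|x y S' xy xS yS _ IHS]; first by rewrite set0U.
rewrite disjoints_subset !subUset !sub1set !in_setC => /and3P[xN yN dS].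
rewrite -disjoints_subset in dS; rewrite -!setUA.
by constructor; rewrite ?inE ?negb_or ?xS ?yS //; apply: IHS.
Qed.

(** No edge inside [A] leaves [C], so each matching edge is kept or dropped as a whole. *)
Lemma matchable_restrict A C S : matchable S -> S \subset A ->
    {in A &, forall x y, adj x y -> (x \in C) = (y \in C)} ->
  matchable (S :&: C).
Proof.
move=> mS sSA cC; elim: mS sSA => [_|x y S' xy xS yS _ IHS].
  by rewrite set0I; constructor.
rewrite !subUset !sub1set => /and3P[xA yA sSA].
have {}IHS := IHS sSA.
have xyC := cC x y xA yA xy; case xC: (x \in C).
  have -> : (x |: (y |: S')) :&: C = x |: (y |: (S' :&: C)).
    rewrite setIUl setIUl; congr (_ :|: (_ :|: _)); apply/setIidPl.
      by rewrite sub1set.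
    by rewrite sub1set -xyC.
  by constructor; rewrite // inE negb_and ?xS ?yS.
have -> : (x |: (y |: S')) :&: C = S' :&: C; last by [].
rewrite !setIUl; apply/setP=> z; rewrite !inE.
by do 2![case: eqP => [->|_]]; rewrite ?xC -?xyC ?xC ?andbF.
Qed.

(* Follow the alternating path of the symmetric difference of two matchings
   (covering S and N) that starts at v: it ends either at a vertex z missed by
   the first matching, or, after an edge of the first matching, at a vertex
   missed by the second one. *)
Lemma matchable_exchange S N v :
    matchable S -> matchable N -> v \in S -> v \notin N ->
  (exists S' z, [/\ matchable S', #|S'| = #|S|, z \in N
                  & S' \subset z |: (S :\ v)])
  \/ (exists N', [/\ matchable N', #|N'| = #|N|.+2 & N' \subset N :|: S]).
Proof.
have [n] := ubnP #|S|; elim: n S N v => // n IHn S N v cS mS mN vS vN.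
have [w [S1 [vw vS1 wS1 mS1 eS]]] := matchable_partner mS vS.
have wv : w != v by rewrite eq_sym adj_neq.
have cS1 : #|S| = #|S1|.+2 by rewrite eS card_matchableU.
(* If the path stops at [w], adding the edge [vw] enlarges [N]. *)
have [wN|wN] := boolP (w \in N); last first.
  right; exists (v |: (w |: N)); split; first by constructor.
    by rewrite card_matchableU.
  by rewrite eS; apply/subsetP=> z; rewrite !inE; case: (z == v);
    case: (z == w); case: (z \in N).
have [t [N1 [wt wN1 tN1 mN1 eN]]] := matchable_partner mN wN.
have [tv vN1] : t != v /\ v \notin N1.
  by move: vN; rewrite eN !inE !negb_or (eq_sym v t) => /and3P[].
have cN : #|N| = #|N1|.+2 by rewrite eN card_matchableU.
have tN : t \in N by rewrite eN !inE eqxx orbT.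
(* If it stops at [t], replacing [vw] by [wt] uncovers [v] and covers [t]. *)
have [tS|tS] := boolP (t \in S); last first.
  have tS1 : t \notin S1 by move: tS; rewrite eS !inE !negb_or => /and3P[].
  left; exists (w |: (t |: S1)), t; split=> //; first by constructor.
    by rewrite card_matchableU.
  apply/subsetP=> z; rewrite eS !inE; case: eqP => [->|_] /=.
    by rewrite wv !orbT.
  case: (z == t) => //= zS1; rewrite zS1 !orbT andbT.
  by apply: contraNneq vS1 => <-.
have tS1 : t \in S1.
  by move: tS; rewrite eS !inE (negPf tv) eq_sym (negPf (adj_neq wt)).
have ltS1 : #|S1| < n by rewrite -ltnS; apply: leq_trans cS; rewrite cS1 leqnSn.
(* Otherwise it continues from [t] with [vw] and [wt] removed. Afterwards the edge [wt] joins the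
   new [S], or [vw] the new [N]. *)
have [] := IHn S1 N1 t ltS1 mS1 mN1 tS1 tN1.
  move=> [S2 [z [mS2 cS2 zN1 sS2]]]; left.
  have zw : z != w by apply: contraNneq wN1 => <-.
  have zt : z != t by apply: contraNneq tN1 => <-.
  have wS2 : w \notin S2.
    apply/negP=> /(subsetP sS2).
    by rewrite !inE (negPf wS1) eq_sym (negPf zw) andbF.
  have tS2 : t \notin S2.
    by apply/negP=> /(subsetP sS2); rewrite !inE eqxx eq_sym (negPf zt).
  exists (w |: (t |: S2)), z; split; first by constructor.
  - by rewrite card_matchableU // cS2.
  - by rewrite eN !inE zN1 !orbT.
  apply/subsetP=> y; rewrite eS !inE => /or3P[/eqP->|/eqP->|/(subsetP sS2)].
  + by rewrite eqxx wv !orbT.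
  + by rewrite tv tS1 !orbT.
  rewrite !inE => /orP[->//|/andP[_ yS1]]; rewrite yS1 !orbT andbT.
  by apply/orP; right; apply: contraNneq vS1 => <-.
move=> [N2 [mN2 cN2 sN2]]; right.
have vN2 : v \notin N2.
  by apply/negP=> /(subsetP sN2); rewrite !inE (negPf vN1) (negPf vS1).
have wN2 : w \notin N2.
  by apply/negP=> /(subsetP sN2); rewrite !inE (negPf wN1) (negPf wS1).
exists (v |: (w |: N2)); split; first by constructor.
  by rewrite card_matchableU // cN2 cN.
rewrite eN eS; apply/subsetP=> y; rewrite !inE => /or3P[->|->|/(subsetP sN2)].
- by rewrite !orbT.
- by rewrite !orbT.
by rewrite inE => /orP[]->; rewrite !orbT.
Qed.

Definition max_matchable A S : bool :=
  [&& S \subset A, matchableb S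
    & [forall N : {set G}, (N \subset A) ==> matchableb N ==> (#|N| <= #|S|)]].

Lemma max_matchableP A S :
  reflect [/\ S \subset A, matchable S
            & forall N, N \subset A -> matchable N -> #|N| <= #|S|]
          (max_matchable A S).
Proof.
apply: (iffP and3P) => -[sSA /matchableP mS maxS]; split=> //.
  move=> N sNA /matchableP mN.
  by have /forallP/(_ N) := maxS; rewrite sNA mN.
apply/forallP=> N; apply/implyP=> sNA; apply/implyP=> /matchableP.
exact: maxS.
Qed.

Lemma max_matchable_exists A : exists S, max_matchable A S.
Proof.
pose P (S : {set G}) := (S \subset A) && matchableb S.
have P0 : P set0 by rewrite /P sub0set; apply/matchableP; constructor.
case: (arg_maxnP (fun S : {set G} => #|S|) P0) => S.
move=> /andP[sSA /matchableP mS] maxS.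
exists S; apply/max_matchableP; split=> // N sNA /matchableP mN.
by apply: maxS; rewrite /P sNA.
Qed.

Lemma max_matchable_eq_card A S N :
  max_matchable A S -> matchable N -> N \subset A -> #|N| = #|S| ->
  max_matchable A N.
Proof.
move=> /max_matchableP[_ _ maxS] mN sNA eNS.
by apply/max_matchableP; split=> // N'; rewrite eNS; apply: maxS.
Qed.

(** The case [x = y] is meaningful: some maximum matching of [A] misses [x]. *)
Definition jointly_missed A x y :=
  [exists S : {set G}, [&& max_matchable A S, x \notin S & y \notin S]].

(** Otherwise the edge [xy] would enlarge a maximum matching. *)
Lemma jointly_missed_adj A :
  {in A &, forall x y, adj x y -> ~~ jointly_missed A x y}.
Proof.
move=> x y xA yA xy; apply/existsP => -[S /and3P[maxS xS yS]].
have {maxS} /max_matchableP[sSA mS maxS] := maxS.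
have := maxS (x |: (y |: S)).
rewrite card_matchableU // !subUset !sub1set xA yA sSA.
by move=> /(_ isT (MatchableU xy xS yS mS)); lia.
Qed.

Lemma jointly_missedC A x y : jointly_missed A x y = jointly_missed A y x.
Proof.
by apply/existsP/existsP => -[S /and3P[mS xS yS]]; exists S; rewrite mS xS yS.
Qed.

(** Suppose [S] misses [u] and [w], while [N] misses [v]; then [S] covers [v]. The alternating path
    from [v] cannot enlarge the maximum [N], so it yields a maximum [S'] that misses [v] and covers
    just one new vertex [z]. *)
Lemma gallai A u v w : u != w -> jointly_missed A v v ->
  ~~ jointly_missed A u v -> ~~ jointly_missed A v w -> ~~ jointly_missed A u w.
Proof.
move=> uw /existsP[N /and3P[mN vN _]] uv vw.
apply/existsP => -[S /and3P[mS uS wS]].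
have vS : v \in S.
  by apply: contraNT uv => vS; apply/existsP; exists S; rewrite mS uS.
have /max_matchableP[sSA pS maxS] := mS.
have /max_matchableP[sNA pN maxN] := mN.
have [[S' [z [pS' cS' zN sS']]]|[N' [pN' cN' sN']]] :=
  matchable_exchange pS pN vS vN; last first.
  have := maxN N'; rewrite cN' => /(_ _ pN').
  rewrite (subset_trans sN') ?subUset ?sNA // => /(_ isT).
  by rewrite ltnNge leqnSn.
have zv : z != v by apply: contraNneq vN => <-.
have vS' : v \notin S'.
  by apply/negP=> /(subsetP sS'); rewrite !inE eqxx eq_sym (negPf zv).
have mS' : max_matchable A S'.
  apply: max_matchable_eq_card mS pS' _ cS'.
  apply: subset_trans sS' _; rewrite subUset sub1set (subsetP sNA) //=.
  exact: subset_trans (subD1set S v) sSA.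
(* Since [z] is not both [u] and [w], [S'] misses one of them together with [v]. *)
have [zu|zu] := eqVneq z u.
  case/negP: vw; apply/existsP; exists S'; rewrite mS' vS' /=.
  apply/negP=> /(subsetP sS').
  by rewrite !inE zu eq_sym (negPf uw) (negPf wS) andbF.
case/negP: uv; apply/existsP; exists S'; rewrite mS' vS' andbT /=.
by apply/negP=> /(subsetP sS'); rewrite !inE eq_sym (negPf zu) (negPf uS) andbF.
Qed.

(** * The induction that bounds the edges inside a set by a matching *)

Hypothesis tfG : triangle_free G.

(** An explicit matching [S] inside [A], not necessarily maximum, lets the matchings and the surplus
    counts [a], [b] of disjoint pieces be added. *)
Lemma degree_sum_matchable d A : max_degree G <= d ->
  exists k a b S, [/\ matchable S, S \subset A, #|S| = k.*2,
    a * d.+1 + b * d <= k & degree_sum A <= (d * k + d %/ 2 * a + b).*2].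
Proof.
move=> dG; have [n] := ubnP #|A|; elim: n A => // n IHn A cA.
have [->|[v0 v0A]] := set_0Vmem A.
  exists 0, 0, 0, set0; rewrite cards0 /degree_sum big_set0.
  by split=> //; constructor.
have [v /andP[vA vm]|allm] := pickP [pred v in A | ~~ jointly_missed A v v].
  have [|k [a [b [S [mS sS cS abk bS]]]]] := IHn (A :\ v).
    by move: cA; rewrite (cardsD1 v) vA.
  have [N mN] := max_matchable_exists A.
  have /max_matchableP[sNA pN maxN] := mN.
  have sSA : S \subset A := subset_trans sS (subD1set A v).
  have vS : v \notin S by apply/negP=> /(subsetP sS); rewrite !inE eqxx.
  (* Every maximum matching of [A] covers [v], so [S] is not maximum; the extra edge of [N] pays for
     the at most [d] edges at [v]. *)
  have ltSN : #|S| < #|N|.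
    rewrite ltn_neqAle maxN // andbT; apply: contra vm => /eqP cSN.
    apply/existsP; exists S; rewrite vS !andbT.
    exact: max_matchable_eq_card mN mS sSA cSN.
  exists (#|N|./2), a, b, N.
  have eN := odd_double_half #|N|.
  rewrite (negPf (matchable_even pN)) add0n in eN.
  split=> //; first by lia.
  rewrite (degree_sumD1 vA); have := leq_trans (degree_in_le A v) dG; nia.
have {}allm v : v \in A -> jointly_missed A v v.
  by move=> vA; have := allm v; rewrite /= vA => /negbFE.
(* The class of [v0], which must be added by hand because [v0] is jointly missed with itself. *)
pose C := [set x in A | (x == v0) || ~~ jointly_missed A x v0].
have sCA : C \subset A by apply/subsetP=> x; rewrite inE => /andP[].
have C_pair : {in C &, forall x y, x != y -> ~~ jointly_missed A x y}.
  move=> x y; rewrite !inE.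
  move=> /andP[xA /orP[/eqP->|xv]] /andP[yA /orP[/eqP->|yv]] xy.
  - by rewrite eqxx in xy.
  - by rewrite jointly_missedC.
  - by [].
  by apply: gallai xy (allm v0 v0A) xv _; rewrite jointly_missedC.
(* Adjacent vertices are never jointly missed, so Gallai's lemma keeps neighbours in the class. *)
have C_step x y : x \in C -> y \in A -> adj x y -> y \in C.
  rewrite !inE => /andP[xA xv] yA xy; rewrite yA /=.
  have yx : ~~ jointly_missed A y x.
    by apply: jointly_missed_adj; rewrite // adj_sym.
  case: eqVneq => //= yv; case/orP: xv => [/eqP <-//|xv].
  exact: gallai yv (allm x xA) yx xv.
have C_closed : {in A &, forall x y, adj x y -> (x \in C) = (y \in C)}.
  move=> x y xA yA xy; apply/idP/idP => H; first exact: C_step xy.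
  by apply: C_step H xA _; rewrite adj_sym.
have [|k1 [a1 [b1 [S1 [mS1 sS1 cS1 abk1 bS1]]]]] := IHn (A :\: C).
  rewrite -ltnS; apply: leq_trans cA; rewrite ltnS; apply: proper_card.
  rewrite properE subDset subsetUr /=; apply/subsetPn; exists v0 => //.
  by rewrite !inE v0A eqxx.
have [S mS] := max_matchable_exists A.
have /max_matchableP[sSA pS maxS] := mS.
have pSC := matchable_restrict pS sSA C_closed.
have eSC := odd_double_half #|S :&: C|.
rewrite (negPf (matchable_even pSC)) add0n in eSC.
(* A maximum matching misses at most one vertex of [C], since no two are jointly missed. *)
have cC : #|C| <= (#|S :&: C|./2).*2.+1.
  rewrite eSC -(cardsID S C) setIC -addn1 leq_add2l.
  rewrite leqNgt; apply/negP.
  move=> /card_gt1P[x [y [/setDP[xC xS] /setDP[yC yS] xy]]].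
  have /negP[] := C_pair x y xC yC xy.
  by apply/existsP; exists S; rewrite mS xS yS.
have [a2 [b2 [abk2 bC]]] := degree_sum_component tfG dG cC.
have dS : [disjoint S1 & S :&: C].
  rewrite disjoint_subset; apply/subsetP=> x /(subsetP sS1).
  by case/setDP=> _ xC; rewrite inE /= in_setI (negPf xC) andbF.
exists (k1 + #|S :&: C|./2), (a1 + a2), (b1 + b2), (S1 :|: (S :&: C)).
split.
- exact: matchable_disjointU.
- rewrite subUset (subset_trans sS1 (subsetDl A C)) /=.
  exact: subset_trans (subsetIr S C) sCA.
- by rewrite cardsU (disjoint_setI0 dS) cards0 subn0 cS1 doubleD eSC.
- by lia.
rewrite (degree_sum_split A C) (setIidPr sCA) big1; first by nia.
move=> x xC; rewrite /degree_in big1 // => y /setDP[yA yC].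
by apply/eqP; rewrite eqb0; apply: contra yC => xy; apply: C_step xC yA xy.
Qed.

End Matchings.

(** * Disjoint unions and additivity of the lower bounds *)

Section DisjointUnion.
Variables G H : sgraph.

Definition sum_adj (u v : G + H) : bool :=
  match u, v with
  | inl x, inl y => adj x y
  | inr x, inr y => adj x y
  | _, _ => false
  end.

Lemma sum_adj_sym : symmetric sum_adj.
Proof. by move=> [x|x] [y|y] //=; rewrite adj_sym. Qed.

Lemma sum_adj_irrefl : irreflexive sum_adj.
Proof. by move=> [x|x] /=; rewrite adj_irrefl. Qed.

Definition sum_graph : sgraph := SGraph sum_adj_sym sum_adj_irrefl.

Lemma matchable_sum (S : {set sum_graph}) : matchable S ->
  matchable [set x : G | inl x \in S] /\ matchable [set y : H | inr y \in S].
Proof.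
elim=> [|u v S' uv uS vS _ [IHG IHH]].
  by split; rewrite (_ : [set _ | _] = set0); try constructor;
    apply/setP=> z; rewrite !inE.
case: u v uv uS vS => [x|x] [y|y] //= xy xS yS; split.
- have -> : [set z | inl z \in inl x |: (inl y |: S')]
            = x |: (y |: [set z | inl z \in S']).
    by apply/setP=> z; rewrite !inE.
  by constructor; rewrite ?inE.
- by have -> : [set z | inr z \in inl x |: (inl y |: S')]
            = [set z | inr z \in S'] by apply/setP=> z; rewrite !inE.
- by have -> : [set z | inl z \in inr x |: (inr y |: S')]
            = [set z | inl z \in S'] by apply/setP=> z; rewrite !inE.
have -> : [set z | inr z \in inr x |: (inr y |: S')]
            = x |: (y |: [set z | inr z \in S']).
    by apply/setP=> z; rewrite !inE.
by constructor; rewrite ?inE.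
Qed.

End DisjointUnion.

Lemma degreeE (G : sgraph) (x : G) : degree x = \sum_y adj x y.
Proof.
by rewrite -degree_inT /degree_in; apply: eq_bigl => y; rewrite in_setT.
Qed.

Lemma sum_degree (G : sgraph) : \sum_(x : G) degree x = (#|edges G|).*2.
Proof.
rewrite -handshake /degree_sum.
by apply: eq_big => [x|x _]; rewrite ?in_setT ?degree_inT.
Qed.

Lemma max_degreeP (G : sgraph) d :
  reflect (forall x : G, degree x <= d) (max_degree G <= d).
Proof.
by apply: (iffP (bigmax_leqP _ _ _)) => dG x *; apply: dG.
Qed.

Definition attained d m k :=
  exists2 G : sgraph, admissible d m G & #|edges G| = k.

Lemma attainedD d m n k l :
  attained d m k -> attained d n l -> attained d (m + n) (k + l).
Proof.
move=> [G [tG /max_degreeP dG /matching_numberP nG] <-].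
move=> [H [tH /max_degreeP dH /matching_numberP nH] <-].
have degl (x : G) : degree (inl x : sum_graph G H) = degree x.
  by rewrite !degreeE big_sumType /= [X in _ + X]big1 ?addn0.
have degr (x : H) : degree (inr x : sum_graph G H) = degree x.
  by rewrite !degreeE big_sumType /= [X in X + _]big1 ?add0n.
exists (sum_graph G H); first split.
- move=> [x|x] [y|y] [z|z] [] //= xy yz xz; first exact: (tG x y z).
  exact: (tH x y z).
- by apply/max_degreeP => -[x|x]; rewrite ?degl ?degr.
- apply/matching_numberP => S /matchable_sum[/nG SG /nH SH].
  rewrite doubleD; apply: leq_trans (leq_add SG SH).
  have cardE (T : finType) (A : {set T}) : #|A| = \sum_x (x \in A).
    by rewrite -sum1_card big_mkcond.
  rewrite !cardE big_sumType /=.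
  by apply: leq_add; apply: leq_sum => x _; rewrite inE.
apply: double_inj; rewrite doubleD -!sum_degree big_sumType /=.
by congr (_ + _); apply: eq_bigr => x _.
Qed.

(** * Concrete graphs checked by computation *)

Section TableGraphs.
Variables (n : nat) (r : rel nat).

(** Symmetrised and loopless, so a table lists each edge in one direction only. *)
Definition table_rel : rel nat := fun i j => (i != j) && (r i j || r j i).

Definition table_adj : rel 'I_n := fun x y => table_rel x y.

Lemma table_adj_sym : symmetric table_adj.
Proof. by move=> x y; rewrite /table_adj /table_rel eq_sym orbC. Qed.

Lemma table_adj_irrefl : irreflexive table_adj.
Proof. by move=> x; rewrite /table_adj /table_rel eqxx. Qed.

Definition table_graph : sgraph := SGraph table_adj_sym table_adj_irrefl.

Definition table_degree i : nat :=
  sumn [seq nat_of_bool (table_rel i j) | j <- iota 0 n].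

(** Stated on natural numbers and lists, so that [vm_compute] decides it; the matching number is
    bounded separately. *)
Definition table_spec d k : bool :=
  let s := iota 0 n in
  [&& all (fun i => all (fun j => table_rel i j ==>
        all (fun l => ~~ (table_rel j l && table_rel i l)) s) s) s,
      all (fun i => table_degree i <= d) s
    & sumn [seq table_degree i | i <- s] == k.*2].

Lemma table_attained d m k : table_spec d k ->
  matching_number table_graph <= m -> attained d m k.
Proof.
case/and3P=> /allP tf /allP dm /eqP es nu.
have io (x : 'I_n) : val x \in iota 0 n by rewrite mem_iota /=.
have eI : iota 0 n = index_iota 0 n by rewrite /index_iota subn0.
have deg (x : table_graph) : degree x = table_degree x.
  by rewrite degreeE /table_degree sumnE big_map eI big_mkord.
exists table_graph; first split=> //.
- move=> x y z [xy yz xz].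
  have /allP/(_ _ (io y))/implyP/(_ xy) := tf _ (io x).
  by move=> /allP/(_ _ (io z))/negP; apply; apply/andP.
- by apply/max_degreeP => x; rewrite deg; apply: (dm _ (io x)).
apply: double_inj; rewrite -sum_degree -es sumnE big_map.
rewrite eI big_mkord; apply: eq_bigr => x _.
exact: deg.
Qed.

(** A matching covers an even number of vertices, hence at most 2m of 2m+1. *)
Lemma small_matching_number m :
  n <= m.*2.+1 -> matching_number table_graph <= m.
Proof.
move=> nm; apply/matching_numberP => S mS.
have := matchable_even mS; have : #|S| <= n by rewrite -[n]card_ord max_card.
by move: nm #|S|; lia.
Qed.

End TableGraphs.

(** Disjoint matching edges use distinct vertices of the cover. Needed for stars, whose order says
    too little. *)
Lemma vertex_cover_matchable (G : sgraph) (K S : {set G}) :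
    (forall x y, adj x y -> (x \in K) || (y \in K)) ->
  matchable S -> #|S| <= (#|K :&: S|).*2.
Proof.
move=> cK; elim=> [|x y N xy xN yN _ IHN]; first by rewrite cards0.
rewrite card_matchableU //.
suff : #|K :&: N| < #|K :&: (x |: (y |: N))|.
  by move: IHN; move: #|K :&: N| #|N| #|_|; lia.
apply: proper_card; apply/properP; split.
  by apply: setIS; rewrite setUA subsetUr.
by case/orP: (cK x y xy) => [xK|yK]; [exists x|exists y];
  rewrite !inE ?eqxx ?xK ?yK ?orbT //= negb_and ?xN ?yN orbT.
Qed.

Lemma attained0 d : attained d 0 0.
Proof.
apply: (@table_attained 0 (fun _ _ => false)) => //.
exact: small_matching_number.
Qed.

Lemma attainedM d m k q : attained d m k -> attained d (q * m) (q * k).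
Proof.
move=> mk; elim: q => [|q IHq]; first exact: attained0.
by rewrite !mulSn; apply: attainedD.
Qed.

Definition star_rel : rel nat := fun i j => i == 0.

Lemma star_attained d : d \in [:: 4; 5; 6] -> attained d 1 d.
Proof.
move=> hd; apply: (@table_attained d.+1 star_rel).
  by move: hd; rewrite !inE => /or3P[]/eqP->; vm_compute.
apply/matching_numberP => S mS.
pose K : {set table_graph d.+1 star_rel} := [set ord0].
apply: leq_trans (vertex_cover_matchable (K := K) _ mS) _.
  move=> x y; rewrite !inE -!val_eqE /= /table_adj /table_rel /star_rel.
  by case/andP.
by rewrite leq_double (leq_trans (subset_leq_card (subsetIl _ _))) ?cards1.
Qed.

(* K_{d,d} on {0..d-1} and {d..2d-1} with the edge {0, d} subdivided by the
   vertex 2d. *)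
Definition subdivided_rel d : rel nat := fun i j =>
  [|| [&& i < d, d <= j, j < d.*2 & (i != 0) || (j != d)],
      (i == 0) && (j == d.*2) | (i == d) && (j == d.*2)].

(** Subdividing turns d^2 edges into d^2 + 1; the order 2d+1 allows only [d] matching edges. *)
Lemma subdivided_attained d : d \in [:: 4; 5; 6] -> attained d d (d * d).+1.
Proof.
move=> hd; apply: (@table_attained d.*2.+1 (subdivided_rel d)).
  by move: hd; rewrite !inE => /or3P[]/eqP->; vm_compute.
exact: small_matching_number.
Qed.

(* Triangle-free graphs on 2d+3 vertices in which all degrees are d, except one
   that is d-1 for d = 5: circulant graphs for d = 4 and d = 6, and a graph
   found by computer search for d = 5. *)
Definition regular_rel d : rel nat := fun i j =>
  match d with
  | 4 => j \in [seq (i + s) %% 11 | s <- [:: 1; 3]]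
  | 5 => j \in nth [::]
           [:: [:: 2; 3; 5; 8; 12]; [:: 3; 4; 8; 9; 12]; [:: 4; 6; 9; 11];
               [:: 6; 7; 10]; [:: 5; 7; 10]; [:: 6; 9; 11]; [:: 8; 12];
               [:: 8; 9; 11]; [:: 10]; [:: 10]; [:: 12]; [:: 12]] i
  | _ => j \in [seq (i + s) %% 15 | s <- [:: 1; 4; 6]]
  end.

(** The edge count is floor(d(2d+3)/2), and the order 2d+3 allows only d+1 matching edges. *)
Lemma regular_attained d : d \in [:: 4; 5; 6] ->
  attained d d.+1 (d * d.+1 + d %/ 2).
Proof.
move=> hd; apply: (@table_attained d.*2.+3 (regular_rel d)).
  by move: hd; rewrite !inE => /or3P[]/eqP->; vm_compute.
exact: small_matching_number.
Qed.

(** * Optimising the upper bound and assembling the extremal graphs *)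

Lemma edges_le_matching (G : sgraph) d m : admissible d m G ->
  exists k a b, [/\ k <= m, a * d.+1 + b * d <= k
    & #|edges G| <= d * k + d %/ 2 * a + b].
Proof.
move=> [tG dG /matching_numberP nG].
have [k [a [b [S [mS _ cS abk bS]]]]] := degree_sum_matchable tG [set: G] dG.
exists k, a, b; split=> //; first by rewrite -leq_double -cS nG.
by rewrite -leq_double -handshake.
Qed.

Theorem theorem7 (d m : nat) (hd : d \in [:: 4; 5; 6]) (hm : d < m) :
  f_triangle d m
    (if d.+1 %| m.+1 then 1 + d * m + (d %/ 2) * (m %/ d.+1)
     else d * m + (d %/ 2) * (m %/ d.+1)).
Proof.
have [h4 h5 h6] : [/\ 4 %/ 2 = 2, 5 %/ 2 = 2 & 6 %/ 2 = 3] by [].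
split; last first.
  move=> G /edges_le_matching[k [a [b [km abk]]]].
  (* A unit of [a] costs d+1 and gains floor(d/2) >= 2, a unit of [b] costs [d] and gains 1. So
     [a = m %/ d.+1] is optimal, leaving room for [b = 1] exactly when the remainder is [d]. *)
  move=> /leq_trans; apply; move: hd abk; rewrite !inE.
  by case/or3P=> /eqP->; rewrite ?h4 ?h5 ?h6; case: ifP; lia.
have Hq := attainedM (m %/ d.+1) (regular_attained hd).
have em := divn_eq m d.+1.
case: ifP => dm.
  (* Here the remainder of [m] is [d], the matching number that the subdivided graph may use. *)
  have := attainedD Hq (subdivided_attained hd).
  congr (attained _ _ _);
    move: hd em dm; rewrite !inE; case/or3P=> /eqP->; rewrite ?h4 ?h5 ?h6; lia.
(* One star for each unit of the remainder. *)
have := attainedD Hq (attainedM (m %% d.+1) (star_attained hd)).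
congr (attained _ _ _);
  move: hd em dm; rewrite !inE; case/or3P=> /eqP->; rewrite ?h4 ?h5 ?h6; lia.
Qed.
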